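(* Let $T\geq 2$, let $n\geq 2T^2$ be an integer, and let $N=\frac{\sqrt{2n+1}+\sqrt{2n+3}}{2}$. Then, for $|x|,|y|\leq T$, $$k_n(x,y)=\frac{1}{\pi}\frac{\sin N(x-y)}{x-y}+R_n(x,y),$$ with $$|R_n(x,y)|\leq\frac{17T^2}{\sqrt{2n+1}}.$$
   Context: $H_k(x)=e^{x^2}\frac{\mathrm{d}^k}{\mathrm{d}x^k}e^{-x^2}$ is the $k$-th Hermite polynomial, $h_k(x)=\frac{1}{\pi^{1/4}\sqrt{2^k k!}}H_k(x)e^{-x^2/2}$ is the $k$-th ($L^2(\mathbb{R})$-normalized) Hermite function, and $k_n(x,y)=\sum_{k=0}^n h_k(x)h_k(y)$ is the kernel of the orthogonal projection of $L^2(\mathbb{R})$ onto the span of $h_0,\ldots,h_n$. At $x=y$ the quotient $\frac{\sin N(x-y)}{x-y}$ is understood as its limit $N$. *)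

(* Defs.v *)
From Stdlib Require Import Reals Factorial.
From Coquelicot Require Import Coquelicot.
Open Scope R_scope.

(* There is no factor [(-1) ^ k]: for odd [k] this is the opposite of the usual
   physicists' Hermite polynomial. *)
Definition hermite_poly (k : nat) (x : R) : R :=
  exp (x ^ 2) * Derive_n (fun t => exp (- t ^ 2)) k x.

Definition hermite_fun (k : nat) (x : R) : R :=
  1 / (Rpower PI (1 / 4) * sqrt (2 ^ k * INR (fact k)))
  * hermite_poly k x * exp (- x ^ 2 / 2).

(* [sum_f_R0 f n] is [f 0 + ... + f n], with [n + 1] terms. *)
Definition hermite_kernel (n : nat) (x y : R) : R :=
  sum_f_R0 (fun k => hermite_fun k x * hermite_fun k y) n.

(* [sin (N u) / u], extended by its limit [N] at [u = 0]. *)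
Definition sin_quotient (N u : R) : R :=
  if Req_EM_T u 0 then N else sin (N * u) / u.

(* Main.v *)
Require Import Defs.
From Stdlib Require Import Reals Factorial Lra Lia.
From Coquelicot Require Import Coquelicot.
Open Scope R_scope.

(** With [b = sqrt (2 n + 2)], the pair [f = h_n], [g = - h_(n+1)] solves the
    planar system [f' = x f - b g], [g' = b f - x g], and Christoffel-Darboux
    expresses [(x - y) k_n(x, y)] as [b / 2] times its Wronskian
    [g x * f y - f x * g y].  For [F+ = f + g] and [F- = f - g] the system reads
    [F+' = (b + x) F-], [F-' = - (b - x) F+]; in the gauge
    [P = (1 - x / (2 b)) F+], [M = (1 + x / (2 b)) F-] it is the rotation
    [P' = b M], [M' = - b P] up to errors of relative size [T^2 / b].  The Wronskian
    is therefore [(P y ^ 2 + M y ^ 2) * sin (b (x - y))] up to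
    [O (T^2 / b) * |x - y|], a bound that survives the division by [x - y].  The
    amplitude [P^2 + M^2] is controlled by an almost conserved energy, whose value at
    the origin comes from Wallis' inequalities. *)

(** * Derivatives of the Gaussian *)

Definition gauss (t : R) : R := exp (- t ^ 2).

(** [Derive_n] is total, so differentiability has to be carried along with the recurrence.
    Differentiating the three-term relation at [k] shows that the derivative of order [k + 2] is
    differentiable and yields the relation at [k + 1]. *)
Lemma gauss_derive_n_rec (k : nat) :
  (forall x, is_derive (Derive_n gauss k) x (Derive_n gauss (S k) x)) /\
  (forall x, is_derive (Derive_n gauss (S k)) x (Derive_n gauss (S (S k)) x)) /\
  (forall x, Derive_n gauss (S (S k)) x
     = - 2 * x * Derive_n gauss (S k) x - 2 * (INR k + 1) * Derive_n gauss k x).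
Proof.
  induction k as [|k [IH0 [IH1 IH2]]].
  - assert (H0 : forall x, is_derive gauss x (- 2 * x * gauss x)).
    { intros x; unfold gauss; auto_derive; [easy | simpl; ring]. }
    assert (E1 : forall x, Derive_n gauss 1 x = - 2 * x * gauss x).
    { intros x; apply is_derive_unique, H0. }
    assert (H1 : forall x, is_derive (Derive_n gauss 1) x
                   (- 2 * x * Derive_n gauss 1 x - 2 * (0 + 1) * gauss x)).
    { intros x; rewrite E1.
      apply is_derive_ext with (f := fun t => - 2 * t * gauss t).
      { intros t; symmetry; apply E1. }
      unfold gauss; auto_derive; [easy | simpl; ring]. }
    assert (E2 : forall x, Derive_n gauss 2 x
                   = - 2 * x * Derive_n gauss 1 x - 2 * (0 + 1) * gauss x).
    { intros x; apply (is_derive_unique (Derive_n gauss 1)), H1. }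
    split; [|split]; intros x.
    + rewrite E1; apply H0.
    + rewrite E2; apply H1.
    + exact (E2 x).
  - assert (H : forall x, is_derive (Derive_n gauss (S (S k))) x
      (- 2 * x * Derive_n gauss (S (S k)) x
         - 2 * (INR (S k) + 1) * Derive_n gauss (S k) x)).
    { intros x.
      apply is_derive_ext with
        (f := fun t => - 2 * t * Derive_n gauss (S k) t
                       - 2 * (INR k + 1) * Derive_n gauss k t).
      { intros t; symmetry; apply IH2. }
      assert (D0 := is_derive_unique _ _ _ (IH0 x)).
      assert (D1 := is_derive_unique _ _ _ (IH1 x)).
      rewrite S_INR; auto_derive.
      - repeat split; [exists (Derive_n gauss (S (S k)) x); apply IH1
                      | exists (Derive_n gauss (S k) x); apply IH0].
      - change (Derive (fun x0 : R => Derive (Derive_n gauss k) x0) x)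
          with (Derive (Derive_n gauss (S k)) x).
        change (Derive (fun x0 : R => Derive_n gauss k x0) x)
          with (Derive (Derive_n gauss k) x).
        rewrite D0, D1; ring. }
    assert (E : forall x, Derive_n gauss (S (S (S k))) x =
      - 2 * x * Derive_n gauss (S (S k)) x
         - 2 * (INR (S k) + 1) * Derive_n gauss (S k) x).
    { intros x; apply (is_derive_unique (Derive_n gauss (S (S k)))), H. }
    split; [|split]; intros x; [apply IH1 | rewrite E; apply H | apply E].
Qed.

Lemma gauss_derive_n (k : nat) (x : R) :
  is_derive (Derive_n gauss k) x (Derive_n gauss (S k) x).
Proof. apply gauss_derive_n_rec. Qed.

Lemma gauss_derive_n_three_term (k : nat) (x : R) :
  Derive_n gauss (S (S k)) x
  = - 2 * x * Derive_n gauss (S k) x - 2 * (INR k + 1) * Derive_n gauss k x.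
Proof. apply gauss_derive_n_rec. Qed.

(** * Ladder relations for the normalized Hermite functions *)

Definition hermite_norm (k : nat) : R :=
  1 / (Rpower PI (1 / 4) * sqrt (2 ^ k * INR (fact k))).

(** The ratio of consecutive normalizing constants; at [k = n] it is the frequency [b] of the planar
    system. *)
Definition ladder (k : nat) : R := sqrt (2 * INR k + 2).

Lemma ladder_pos (k : nat) : 0 < ladder k.
Proof. apply sqrt_lt_R0; generalize (pos_INR k); lra. Qed.

Lemma ladder_sqr (k : nat) : ladder k * ladder k = 2 * INR k + 2.
Proof. apply sqrt_sqrt; generalize (pos_INR k); lra. Qed.

Lemma hermite_norm_S (k : nat) : ladder k * hermite_norm (S k) = hermite_norm k.
Proof.
  unfold hermite_norm.
  replace (2 ^ S k * INR (fact (S k)))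
    with ((2 * INR k + 2) * (2 ^ k * INR (fact k)))
    by (rewrite fact_simpl, mult_INR, S_INR; simpl; ring).
  assert (Hk : 0 < 2 ^ k * INR (fact k)).
  { apply Rmult_lt_0_compat; [apply pow_lt; lra | apply INR_fact_lt_0]. }
  rewrite sqrt_mult by (generalize (pos_INR k); lra).
  fold (ladder k).
  assert (H := ladder_pos k).
  assert (H1 := sqrt_lt_R0 _ Hk).
  assert (H2 : 0 < Rpower PI (1 / 4)) by apply exp_pos.
  field; lra.
Qed.

Lemma hermite_fun_gauss (k : nat) (x : R) :
  hermite_fun k x
  = hermite_norm k * (exp (x ^ 2) * Derive_n gauss k x) * exp (- x ^ 2 / 2).
Proof. reflexivity. Qed.

(** The term in [2 * x] has the opposite of its usual sign because [hermite_poly] has no factor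
    [(-1) ^ k]. *)
Lemma hermite_fun_three_term (k : nat) (x : R) :
  ladder (S k) * hermite_fun (S (S k)) x
  = - 2 * x * hermite_fun (S k) x - ladder k * hermite_fun k x.
Proof.
  rewrite !hermite_fun_gauss, gauss_derive_n_three_term.
  rewrite <- (hermite_norm_S k), <- (hermite_norm_S (S k)).
  replace (2 * (INR k + 1)) with (ladder k * ladder k)
    by (rewrite ladder_sqr; ring).
  ring.
Qed.

Lemma hermite_fun_1 (x : R) : ladder 0 * hermite_fun 1 x = - 2 * x * hermite_fun 0 x.
Proof.
  rewrite !hermite_fun_gauss, <- (hermite_norm_S 0).
  replace (Derive_n gauss 1 x) with (- 2 * x * Derive_n gauss 0 x); [ring |].
  symmetry; apply is_derive_unique; simpl; unfold gauss; auto_derive; [easy | simpl; ring].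
Qed.

Lemma hermite_fun_derive (k : nat) (x : R) :
  is_derive (hermite_fun k) x (x * hermite_fun k x + ladder k * hermite_fun (S k) x).
Proof.
  apply is_derive_ext with
    (f := fun t => hermite_norm k * (exp (t ^ 2) * Derive_n gauss k t) * exp (- t ^ 2 / 2)).
  { intros t; symmetry; apply hermite_fun_gauss. }
  assert (D := is_derive_unique _ _ _ (gauss_derive_n k x)).
  auto_derive.
  - repeat split; exists (Derive_n gauss (S k) x); apply gauss_derive_n.
  - change (Derive (fun x0 : R => Derive_n gauss k x0) x)
      with (Derive (Derive_n gauss k) x).
    rewrite D, !hermite_fun_gauss, <- (hermite_norm_S k).
    unfold Rdiv; simpl (x ^ 2); field.
Qed.

(** Eliminating the function of index [k + 2] by the three-term relation closes the differential
    system on the indices [k] and [k + 1]. *)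
Lemma hermite_fun_derive_S (k : nat) (x : R) :
  is_derive (hermite_fun (S k)) x
    (- ladder k * hermite_fun k x - x * hermite_fun (S k) x).
Proof.
  replace (- ladder k * hermite_fun k x - x * hermite_fun (S k) x)
    with (x * hermite_fun (S k) x + ladder (S k) * hermite_fun (S (S k)) x).
  { apply hermite_fun_derive. }
  rewrite hermite_fun_three_term; ring.
Qed.

(** * Christoffel-Darboux formulas *)

Lemma christoffel_darboux (n : nat) (x y : R) :
  (x - y) * hermite_kernel n x y
  = ladder n / 2 * (hermite_fun n x * hermite_fun (S n) y
                    - hermite_fun (S n) x * hermite_fun n y).
Proof.
  unfold hermite_kernel.
  induction n as [|n IH].
  - simpl sum_f_R0.
    generalize (hermite_fun_1 x) (hermite_fun_1 y); intros Hx Hy.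
    transitivity (/ 2 * (hermite_fun 0 x * (ladder 0 * hermite_fun 1 y)
                    - (ladder 0 * hermite_fun 1 x) * hermite_fun 0 y)); [|field].
    rewrite Hx, Hy; field.
  - rewrite tech5, Rmult_plus_distr_l, IH.
    transitivity (/ 2 *
      (hermite_fun (S n) x * (ladder (S n) * hermite_fun (S (S n)) y)
       - (ladder (S n) * hermite_fun (S (S n)) x) * hermite_fun (S n) y)); [|field].
    rewrite !hermite_fun_three_term; field.
Qed.

(** A separate induction avoids the limit [y -> x]. For the pair [f], [g] the right-hand side is
    [b / 2] times the [energy] defined below. *)
Lemma christoffel_darboux_diag (n : nat) (x : R) :
  hermite_kernel n x x
  = ladder n / 2 * (ladder n * (hermite_fun n x ^ 2 + hermite_fun (S n) x ^ 2)
                    + 2 * x * hermite_fun n x * hermite_fun (S n) x).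
Proof.
  unfold hermite_kernel.
  induction n as [|n IH].
  - simpl sum_f_R0.
    transitivity (/ 2 * ((ladder 0 * ladder 0) * hermite_fun 0 x ^ 2
        + (ladder 0 * hermite_fun 1 x) ^ 2
        + 2 * x * hermite_fun 0 x * (ladder 0 * hermite_fun 1 x))); [|field].
    rewrite hermite_fun_1, ladder_sqr; simpl INR; field.
  - rewrite tech5, IH.
    transitivity (/ 2 * ((ladder (S n) * ladder (S n)) * hermite_fun (S n) x ^ 2
        + (ladder (S n) * hermite_fun (S (S n)) x) ^ 2
        + 2 * x * hermite_fun (S n) x * (ladder (S n) * hermite_fun (S (S n)) x))); [|field].
    rewrite hermite_fun_three_term, ladder_sqr, S_INR.
    replace (2 * (INR n + 1) + 2) with (ladder n * ladder n + 2)
      by (rewrite ladder_sqr; ring).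
    field.
Qed.

(** * Wallis integrals *)

Definition wallis (k : nat) : R := RInt (fun t => sin t ^ k) 0 (PI / 2).

Lemma continuous_sin_pow (k : nat) (t : R) : continuous (fun t => sin t ^ k) t.
Proof. apply (ex_derive_continuous (fun t => sin t ^ k)); auto_derive; easy. Qed.

Lemma ex_RInt_sin_pow (k : nat) : ex_RInt (fun t => sin t ^ k) 0 (PI / 2).
Proof. apply (ex_RInt_continuous (V := R_CompleteNormedModule)); intros; apply continuous_sin_pow. Qed.

Lemma wallis_0 : wallis 0 = PI / 2.
Proof.
  unfold wallis; simpl; rewrite RInt_const.
  change (scal (PI / 2 - 0) 1) with ((PI / 2 - 0) * 1); ring.
Qed.

Lemma wallis_1 : wallis 1 = 1.
Proof.
  apply is_RInt_unique.
  replace 1 with (minus (- cos (PI / 2)) (- cos 0))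
    by (rewrite cos_PI2, cos_0; unfold minus, plus, opp; simpl; ring).
  apply (is_RInt_derive (fun t => - cos t)).
  - intros t _; auto_derive; [easy | ring].
  - intros t _; apply continuous_sin_pow.
Qed.

(** Integration by parts in disguise: the difference of the integrands has the primitive
    [- cos t * sin t ^ (k + 1)], which vanishes at both ends. *)
Lemma wallis_SS (k : nat) : (INR k + 2) * wallis (S (S k)) = (INR k + 1) * wallis k.
Proof.
  assert (H : is_RInt (fun t => (INR k + 2) * sin t ^ S (S k) - (INR k + 1) * sin t ^ k)
                0 (PI / 2) 0).
  { replace 0 with (minus (- cos (PI / 2) * sin (PI / 2) ^ S k)
                          (- cos 0 * sin 0 ^ S k)) at 2
      by (rewrite cos_PI2, sin_0; unfold minus, plus, opp; simpl; ring).
    apply (is_RInt_derive (fun t => - cos t * sin t ^ S k)).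
    - intros t _; auto_derive; [easy |].
      assert (Hs := sin2_cos2 t); unfold Rsqr in Hs.
      change (match k with 0%nat => 1 | S _ => INR k + 1 end) with (INR (S k)).
      rewrite S_INR.
      replace (sin t ^ S (S k)) with ((sin t * sin t) * sin t ^ k) by (simpl; ring).
      replace (sin t * sin t) with (1 - cos t * cos t) by lra.
      transitivity ((sin t * sin t) * sin t ^ k - cos t * cos t * (INR k + 1) * sin t ^ k);
        [ring |].
      replace (sin t * sin t) with (1 - cos t * cos t) by lra; ring.
    - intros t _.
      apply (ex_derive_continuous
        (fun t => (INR k + 2) * sin t ^ S (S k) - (INR k + 1) * sin t ^ k)).
      auto_derive; easy. }
  assert (W : forall j c, is_RInt (fun t => c * sin t ^ j) 0 (PI / 2) (c * wallis j)).
  { intros j c; apply (is_RInt_scal (fun t => sin t ^ j)).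
    apply (RInt_correct (V := R_CompleteNormedModule)), ex_RInt_sin_pow. }
  assert (H' := is_RInt_minus _ _ _ _ _ _ (W (S (S k)) (INR k + 2)) (W k (INR k + 1))).
  assert (E := eq_trans (eq_sym (is_RInt_unique (V := R_CompleteNormedModule) _ _ _ _ H'))
                 (is_RInt_unique (V := R_CompleteNormedModule) _ _ _ _ H)).
  unfold minus, plus, opp in E; simpl in E; lra.
Qed.

Lemma wallis_S_le (k : nat) : 0 <= wallis (S k) <= wallis k.
Proof.
  assert (HPI := PI_RGT_0).
  assert (Hs : forall t, 0 < t < PI / 2 -> 0 <= sin t <= 1).
  { intros t Ht; split; [apply sin_ge_0; lra | apply SIN_bound]. }
  split.
  - apply RInt_ge_0; [lra | apply ex_RInt_sin_pow |].
    intros t Ht; apply pow_le, Hs, Ht.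
  - apply RInt_le; [lra | apply ex_RInt_sin_pow | apply ex_RInt_sin_pow |].
    intros t Ht; specialize (Hs t Ht).
    assert (0 <= sin t ^ k) by (apply pow_le; lra).
    simpl; nra.
Qed.

(** The recurrence makes this product independent of [k]; monotonicity then turns it into two-sided
    bounds on [wallis k ^ 2]. *)
Lemma wallis_mul_S (k : nat) : (INR k + 1) * wallis (S k) * wallis k = PI / 2.
Proof.
  induction k as [|k IH].
  - rewrite wallis_0, wallis_1; simpl; ring.
  - rewrite S_INR.
    replace ((INR k + 1 + 1) * wallis (S (S k)))
      with ((INR k + 2) * wallis (S (S k))) by ring.
    rewrite wallis_SS; lra.
Qed.

Lemma wallis_sqr_ge (k : nat) : PI / 2 <= (INR k + 1) * wallis k ^ 2.
Proof.
  rewrite <- (wallis_mul_S k).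
  assert (H := wallis_S_le k); assert (Hk := pos_INR k).
  assert (wallis (S k) * wallis k <= wallis k * wallis k) by nra.
  nra.
Qed.

Lemma wallis_sqr_le (k : nat) : INR k * wallis k ^ 2 <= PI / 2.
Proof.
  destruct k as [|k]; [simpl; generalize PI_RGT_0; lra |].
  rewrite <- (wallis_mul_S k), S_INR.
  assert (H := wallis_S_le k); assert (Hk := pos_INR k).
  assert (wallis (S k) * wallis (S k) <= wallis (S k) * wallis k) by nra.
  nra.
Qed.

(** * Hermite functions at the origin *)

Lemma hermite_fun_0_sqr : hermite_fun 0 0 ^ 2 * sqrt PI = 1.
Proof.
  rewrite hermite_fun_gauss; unfold hermite_norm, gauss; simpl.
  replace (0 * (0 * 1)) with 0 by ring.
  replace (- 0 / 2) with 0 by field.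
  rewrite Ropp_0, exp_0, (Rmult_1_r 1), sqrt_1, <- (Rpower_sqrt PI PI_RGT_0).
  replace (/ 2) with (1 / 4 + 1 / 4) by field.
  rewrite Rpower_plus.
  assert (0 < Rpower PI (1 / 4)) by apply exp_pos.
  field; lra.
Qed.

Lemma hermite_fun_odd_0 (m : nat) : hermite_fun (S (2 * m)) 0 = 0.
Proof.
  induction m as [|m IH].
  - generalize (hermite_fun_1 0) (ladder_pos 0); simpl; intros; nra.
  - replace (2 * S m)%nat with (S (S (2 * m))) by lia.
    generalize (hermite_fun_three_term (S (2 * m)) 0) (ladder_pos (S (S (2 * m)))).
    rewrite IH; intros; nra.
Qed.

(** At the origin the three-term relation multiplies the squared value by [(2 m + 1) / (2 m + 2)],
    which is also the ratio of successive even Wallis integrals. *)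
Lemma hermite_fun_even_0 (m : nat) :
  wallis (2 * m) = PI / 2 * sqrt PI * hermite_fun (2 * m) 0 ^ 2.
Proof.
  induction m as [|m IH].
  - simpl (2 * 0)%nat; rewrite wallis_0.
    transitivity (PI / 2 * (hermite_fun 0 0 ^ 2 * sqrt PI)); [|ring].
    rewrite hermite_fun_0_sqr; ring.
  - replace (2 * S m)%nat with (S (S (2 * m))) by lia.
    assert (W := wallis_SS (2 * m)); rewrite IH in W.
    assert (H := hermite_fun_three_term (2 * m) 0).
    assert (H2 : (ladder (S (2 * m)) * ladder (S (2 * m))) * hermite_fun (S (S (2 * m))) 0 ^ 2
      = (ladder (2 * m) * ladder (2 * m)) * hermite_fun (2 * m) 0 ^ 2).
    { transitivity ((ladder (S (2 * m)) * hermite_fun (S (S (2 * m))) 0) ^ 2); [ring |].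
      rewrite H; ring. }
    rewrite !ladder_sqr, S_INR in H2.
    assert (Hk := pos_INR (2 * m)).
    apply (Rmult_eq_reg_l (INR (2 * m) + 2)); [|lra].
    rewrite W.
    transitivity (PI / 2 * sqrt PI * (((2 * INR (2 * m) + 2) * hermite_fun (2 * m) 0 ^ 2) / 2));
      [field |].
    rewrite <- H2; field.
Qed.

(** Squaring removes the factor [sqrt PI]. The two bounds pin [PI * h ^ 2] near [sqrt (2 / (2 m))],
    so that [b * h ^ 2] will be near [2 / PI]. *)
Lemma hermite_fun_even_0_bounds (m : nat) :
  2 <= (INR (2 * m) + 1) * (PI * hermite_fun (2 * m) 0 ^ 2) ^ 2 /\
  INR (2 * m) * (PI * hermite_fun (2 * m) 0 ^ 2) ^ 2 <= 2.
Proof.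
  assert (L := wallis_sqr_ge (2 * m)); assert (U := wallis_sqr_le (2 * m)).
  rewrite hermite_fun_even_0 in L, U.
  assert (HPI := PI_RGT_0).
  assert (Hs : sqrt PI * sqrt PI = PI) by (apply sqrt_sqrt; lra).
  set (h := hermite_fun (2 * m) 0) in *.
  replace ((PI / 2 * sqrt PI * h ^ 2) ^ 2) with (PI / 4 * (PI * h ^ 2) ^ 2) in L, U
    by (transitivity (PI ^ 2 / 4 * (sqrt PI * sqrt PI) * h ^ 4); [rewrite Hs |]; field).
  split; apply (Rmult_le_reg_l (PI / 4)); lra.
Qed.

(** * Elementary mean value estimates *)

Lemma mean_value (F dF : R -> R) (a b : R) :
  (forall t, is_derive F t (dF t)) ->
  exists c, Rmin a b <= c <= Rmax a b /\ F b - F a = dF c * (b - a).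
Proof.
  intros HF; apply MVT_gen; intros t _; [apply HF |].
  apply continuity_pt_filterlim.
  apply (ex_derive_continuous F); exists (dF t); apply HF.
Qed.

Lemma Rabs_between (T x y c : R) :
  Rabs x <= T -> Rabs y <= T -> Rmin x y <= c <= Rmax x y -> Rabs c <= T.
Proof.
  intros Hx Hy Hc; apply Rabs_le_between in Hx, Hy; apply Rabs_le_between.
  unfold Rmin, Rmax in Hc; destruct (Rle_dec x y); lra.
Qed.

Lemma Rabs_sin_minus_le (u v : R) : Rabs (sin u - sin v) <= Rabs (u - v).
Proof.
  destruct (mean_value sin cos v u) as [c [_ ->]].
  { intros t; auto_derive; [easy | ring]. }
  rewrite Rabs_mult.
  assert (Rabs (cos c) <= 1) by (apply Rabs_le_between, COS_bound).
  generalize (Rabs_pos (u - v)); nra.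
Qed.

(** * The planar system and its almost conserved energy *)

Definition ladder_system (b : R) (f g : R -> R) : Prop :=
  forall x, is_derive f x (x * f x - b * g x) /\ is_derive g x (b * f x - x * g x).

(** This is half of [(b - x) F+^2 + (b + x) F-^2], the Hamiltonian of the system in [F+] and [F-];
    only the explicit [x] contributes to its derivative. *)
Definition energy (b : R) (f g : R -> R) (x : R) : R :=
  b * (f x ^ 2 + g x ^ 2) - 2 * x * f x * g x.

(* The energy has derivative [- 2 f g], too large for a bound of order
   [T^2 / b^2]; but [f g] oscillates, and [- 2 f g] is up to lower order the
   derivative of the subtracted term. *)
Definition corrected_energy (b : R) (f g : R -> R) (x : R) : R :=
  energy b f g x - (f x ^ 2 - g x ^ 2) / (2 * b).

Lemma corrected_energy_derive (b : R) (f g : R -> R) (x : R) :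
  0 < b -> ladder_system b f g ->
  is_derive (corrected_energy b f g) x (- (x / b) * (f x ^ 2 + g x ^ 2)).
Proof.
  intros Hb Hfg; destruct (Hfg x) as [Hf Hg].
  unfold corrected_energy, energy; auto_derive.
  - repeat split; eexists; eassumption.
  - change (Derive (fun x0 => f x0) x) with (Derive f x).
    change (Derive (fun x0 => g x0) x) with (Derive g x).
    rewrite (is_derive_unique _ _ _ Hf), (is_derive_unique _ _ _ Hg).
    simpl; field; lra.
Qed.

(** Since [|x| <= b / 2], the cross term costs at most half of [b * (f ^ 2 + g ^ 2)]; since
    [b ^ 2 >= 18], the correction costs at most [1 / 36] of it. What remains is [17 / 36]. *)
Lemma corrected_energy_ge (b T : R) (f g : R -> R) (x : R) :
  2 <= T -> 0 < b -> 4 * T ^ 2 + 2 <= b ^ 2 -> Rabs x <= T ->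
  17 / 36 * b * (f x ^ 2 + g x ^ 2) <= corrected_energy b f g x.
Proof.
  intros HT Hb HbT Hx; apply Rabs_le_between in Hx.
  unfold corrected_energy, energy.
  assert (Hb2T : 2 * T <= b) by nra.
  assert (Hi : / b <= b / 18).
  { apply (Rmult_le_reg_l b); [lra |]; rewrite Rinv_r by lra; nra. }
  replace ((f x ^ 2 - g x ^ 2) / (2 * b)) with ((f x ^ 2 - g x ^ 2) * / b / 2)
    by (field; lra).
  assert (0 < / b) by (apply Rinv_0_lt_compat; lra).
  set (p := f x) in *; set (q := g x) in *; set (i := / b) in *.
  assert (H1 : 2 * x * p * q <= b / 2 * (p ^ 2 + q ^ 2)).
  { assert (0 <= (b / 2 - x) * (p + q) ^ 2)
      by (apply Rmult_le_pos; [lra | apply pow2_ge_0]).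
    assert (0 <= (b / 2 + x) * (p - q) ^ 2)
      by (apply Rmult_le_pos; [lra | apply pow2_ge_0]).
    nra. }
  assert (H2 : (p ^ 2 - q ^ 2) * i <= b / 18 * (p ^ 2 + q ^ 2)).
  { generalize (pow2_ge_0 p) (pow2_ge_0 q); intros.
    assert (p ^ 2 * i <= p ^ 2 * (b / 18)) by (apply Rmult_le_compat_l; lra).
    nra. }
  lra.
Qed.

(** The derivative has the sign of [- x], so the corrected energy is largest at the origin. By
    coercivity that value bounds [f ^ 2 + g ^ 2] at the intermediate point, and no Gronwall argument
    is needed. *)
Lemma corrected_energy_decr (b T : R) (f g : R -> R) (x : R) :
  2 <= T -> 0 < b -> 4 * T ^ 2 + 2 <= b ^ 2 -> ladder_system b f g -> Rabs x <= T ->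
  0 <= corrected_energy b f g 0 - corrected_energy b f g x
    <= 36 / 17 * corrected_energy b f g 0 * T ^ 2 / b ^ 2.
Proof.
  intros HT Hb HbT Hfg.
  assert (Hdiff : forall y, exists c, Rmin 0 y <= c <= Rmax 0 y /\
    corrected_energy b f g 0 - corrected_energy b f g y
      = (c * y) * ((f c ^ 2 + g c ^ 2) / b)).
  { intros y.
    destruct (mean_value (corrected_energy b f g)
      (fun t => - (t / b) * (f t ^ 2 + g t ^ 2)) 0 y) as [c [Hc E]].
    { intros t; apply corrected_energy_derive; assumption. }
    exists c; split; [exact Hc |].
    replace (corrected_energy b f g 0 - corrected_energy b f g y)
      with (- (corrected_energy b f g y - corrected_energy b f g 0)) by ring.
    rewrite E; field; lra. }
  assert (Hcy : forall y c, Rmin 0 y <= c <= Rmax 0 y -> 0 <= c * y <= y ^ 2).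
  { intros y c; unfold Rmin, Rmax; destruct (Rle_dec 0 y); nra. }
  assert (Hquot : forall c, 0 <= (f c ^ 2 + g c ^ 2) / b).
  { intros c; apply Rdiv_le_0_compat; [|lra].
    generalize (pow2_ge_0 (f c)) (pow2_ge_0 (g c)); lra. }
  assert (Hdecr : forall y,
    0 <= corrected_energy b f g 0 - corrected_energy b f g y).
  { intros y; destruct (Hdiff y) as [c [Hc E]]; rewrite E.
    apply Rmult_le_pos; [apply (Hcy y c Hc) | apply Hquot]. }
  intros Hx; split; [apply Hdecr |].
  destruct (Hdiff x) as [c [Hc E]]; rewrite E.
  assert (HcT : Rabs c <= T).
  { apply (Rabs_between T 0 x); trivial; rewrite Rabs_R0; lra. }
  assert (Hge := corrected_energy_ge b T f g c HT Hb HbT HcT).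
  assert (Hd := Hdecr c).
  assert (HxT : x ^ 2 <= T ^ 2) by (apply Rabs_le_between in Hx; nra).
  replace (36 / 17 * corrected_energy b f g 0 * T ^ 2 / b ^ 2)
    with (T ^ 2 * (36 / 17 * corrected_energy b f g 0 / b / b)) by (field; lra).
  apply Rmult_le_compat; [apply (Hcy x c Hc) | apply Hquot
    | generalize (Hcy x c Hc); lra |].
  apply Rmult_le_compat_r; [left; apply Rinv_0_lt_compat; lra |].
  apply (Rmult_le_reg_l b); [lra |].
  replace (b * (36 / 17 * corrected_energy b f g 0 / b))
    with (36 / 17 * corrected_energy b f g 0) by (field; lra).
  lra.
Qed.

Lemma inv_PI_bounds : 0 < 1 / PI <= 1 / 3.
Proof.
  assert (H := PI2_3_2).
  split; [apply Rdiv_lt_0_compat; lra |].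
  apply (Rmult_le_reg_r (3 * PI)); [lra | field_simplify; lra].
Qed.

Lemma amplitude_bounds (b T : R) (f g : R -> R) (x : R) :
  2 <= T -> 0 < b -> 4 * T ^ 2 + 2 <= b ^ 2 -> ladder_system b f g ->
  Rabs (corrected_energy b f g 0 - 2 / PI) <= T ^ 2 / (2 * b ^ 2) ->
  Rabs x <= T ->
  f x ^ 2 + g x ^ 2 <= 17 / 10 / b /\
  Rabs (energy b f g x - 2 / PI) <= 5 / 2 * T ^ 2 / b ^ 2.
Proof.
  intros HT Hb HbT Hfg H0 Hx.
  assert (Hge := corrected_energy_ge b T f g x HT Hb HbT Hx).
  assert (Hdecr := corrected_energy_decr b T f g x HT Hb HbT Hfg Hx).
  set (K := T ^ 2 / b ^ 2).
  assert (HbK : K * b ^ 2 = T ^ 2) by (unfold K; field; lra).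
  assert (HK : 0 <= K <= 1 / 4).
  { assert (Hb2 : 0 < b ^ 2) by (apply pow_lt; lra).
    split; [apply Rdiv_le_0_compat; [apply pow2_ge_0 | lra] |].
    apply (Rmult_le_reg_r (b ^ 2)); lra. }
  replace (T ^ 2 / (2 * b ^ 2)) with (K / 2) in H0 by (unfold K; field; lra).
  replace (36 / 17 * corrected_energy b f g 0 * T ^ 2 / b ^ 2)
    with (36 / 17 * corrected_energy b f g 0 * K) in Hdecr by (unfold K; field; lra).
  replace (5 / 2 * T ^ 2 / b ^ 2) with (5 / 2 * K) by (unfold K; field; lra).
  assert (HPI := inv_PI_bounds).
  replace (2 / PI) with (2 * (1 / PI)) in * by (unfold Rdiv; ring).
  apply Rabs_le_between in H0.
  set (G0 := corrected_energy b f g 0) in *.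
  (* From [1 / PI <= 1 / 3] and [K <= 1 / 4]: [2 / 3 + 1 / 8 < 4 / 5]. Coercivity then gives
     [36 / 17 * 4 / 5 < 17 / 10]. *)
  assert (HG0 : G0 <= 4 / 5) by lra.
  assert (HD : b * (f x ^ 2 + g x ^ 2) <= 17 / 10) by lra.
  split.
  { apply (Rmult_le_reg_l b); [lra |].
    replace (b * (17 / 10 / b)) with (17 / 10) by (field; lra); exact HD. }
  assert (HG0K : G0 * K <= 4 / 5 * K) by (apply Rmult_le_compat_r; lra).
  (* Here [K / (2 T^2)] is [1 / (2 b^2)], and [T^2 >= 4] bounds it by [K / 8]. The total is
     [1 / 2 + 144 / 85 + 17 / 80 < 5 / 2]: initial error, decrease, correction. *)
  assert (HE : Rabs ((f x ^ 2 - g x ^ 2) / (2 * b)) <= 17 / 80 * K).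
  { replace ((f x ^ 2 - g x ^ 2) / (2 * b))
      with ((b * (f x ^ 2 - g x ^ 2)) * (K / (2 * T ^ 2)))
      by (unfold K; field; split; nra).
    assert (Hi : 0 <= K / (2 * T ^ 2) <= K / 8).
    { split; [apply Rdiv_le_0_compat; nra |].
      apply Rmult_le_compat_l; [lra |].
      apply Rinv_le_contravar; nra. }
    rewrite Rabs_mult, (Rabs_right (K / (2 * T ^ 2))) by lra.
    apply Rle_trans with (17 / 10 * (K / 8)); [|lra].
    apply Rmult_le_compat; [apply Rabs_pos | lra | | lra].
    generalize (pow2_ge_0 (f x)) (pow2_ge_0 (g x)); intros.
    apply Rabs_le_between; split; nra. }
  apply Rabs_le_between in HE.
  unfold corrected_energy at 1 2 in Hdecr.
  apply Rabs_le_between; lra.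
Qed.

(** * Comparison of the Wronskian with a sine *)

(** The gauge absorbs the terms of size [|t|] in the system and leaves residues [e1], [e2] with
    coefficients of size [(1 + t^2) / b]. The mean value theorem then supplies the factor
    [|x - y|]. *)
Lemma rotated_gauge_mean_value (b T : R) (f g : R -> R) (x y : R) :
  2 <= T -> 0 < b -> 4 * T ^ 2 + 2 <= b ^ 2 -> ladder_system b f g ->
  (forall t, Rabs t <= T -> f t ^ 2 + g t ^ 2 <= 17 / 10 / b) ->
  Rabs x <= T -> Rabs y <= T ->
  let P := fun t => (1 - t / (2 * b)) * (f t + g t) in
  let M := fun t => (1 + t / (2 * b)) * (f t - g t) in
  Rabs (P x * M y - M x * P y - (P y ^ 2 + M y ^ 2) * sin (b * (x - y)))
    <= 27 / 5 * T ^ 2 / b ^ 2 * Rabs (x - y).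
Proof.
  intros HT Hb HbT Hfg HD Hx Hy P M.
  set (e1 := fun t => - / (2 * b) * ((f t + g t) + t ^ 2 * (f t - g t))).
  set (e2 := fun t => / (2 * b) * ((f t - g t) + t ^ 2 * (f t + g t))).
  assert (HP : forall t, is_derive P t (b * M t + e1 t)).
  { intros t; destruct (Hfg t) as [Hf Hg]; unfold P, M, e1; auto_derive.
    - repeat split; eexists; eassumption.
    - change (Derive (fun x0 => f x0) t) with (Derive f t).
      change (Derive (fun x0 => g x0) t) with (Derive g t).
      rewrite (is_derive_unique _ _ _ Hf), (is_derive_unique _ _ _ Hg).
      simpl; field; lra. }
  assert (HM : forall t, is_derive M t (- b * P t + e2 t)).
  { intros t; destruct (Hfg t) as [Hf Hg]; unfold P, M, e2; auto_derive.
    - repeat split; eexists; eassumption.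
    - change (Derive (fun x0 => f x0) t) with (Derive f t).
      change (Derive (fun x0 => g x0) t) with (Derive g t).
      rewrite (is_derive_unique _ _ _ Hf), (is_derive_unique _ _ _ Hg).
      simpl; field; lra. }
  (* [Psi x] is the gauged Wronskian and [Psi y] its sine approximation; the exact
     rotation would leave [Psi] constant. *)
  set (Psi := fun t => (P t * M y - M t * P y) * cos (b * (x - t))
                       + (M t * M y + P t * P y) * sin (b * (x - t))).
  set (dPsi := fun t =>
    e1 t * (M y * cos (b * (x - t)) + P y * sin (b * (x - t)))
    + e2 t * (M y * sin (b * (x - t)) - P y * cos (b * (x - t)))).
  destruct (mean_value Psi dPsi y x) as [c [Hc E]].
  { intros t; unfold Psi, dPsi; auto_derive.
    - repeat split; [eexists; apply HP | eexists; apply HM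
                    | eexists; apply HM | eexists; apply HP].
    - change (Derive (fun x0 => P x0) t) with (Derive P t).
      change (Derive (fun x0 => M x0) t) with (Derive M t).
      rewrite (is_derive_unique _ _ _ (HP t)), (is_derive_unique _ _ _ (HM t)).
      change (x + - t) with (x - t); ring. }
  assert (HcT : Rabs c <= T) by (apply (Rabs_between T y x); assumption).
  assert (EPsi : P x * M y - M x * P y - (P y ^ 2 + M y ^ 2) * sin (b * (x - y))
                 = Psi x - Psi y).
  { unfold Psi; replace (b * (x - x)) with 0 by ring.
    rewrite cos_0, sin_0; ring. }
  rewrite EPsi, E, Rabs_mult.
  apply Rmult_le_compat_r; [apply Rabs_pos |].
  (* The sum norm of [(F+, F-)]; its square is at most [4 * (f ^ 2 + g ^ 2)]. *)
  set (s := fun t => Rabs (f t + g t) + Rabs (f t - g t)).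
  assert (Hs0 : forall t, 0 <= s t).
  { intros t; unfold s; generalize (Rabs_pos (f t + g t)) (Rabs_pos (f t - g t)); lra. }
  assert (Hs : forall t, Rabs t <= T -> s t ^ 2 <= 34 / 5 / b).
  { intros t Ht; specialize (HD t Ht).
    replace (34 / 5 / b) with (4 * (17 / 10 / b)) by (field; lra).
    assert (s t ^ 2 <= 2 * (Rabs (f t + g t) ^ 2 + Rabs (f t - g t) ^ 2)).
    { unfold s; generalize (pow2_ge_0 (Rabs (f t + g t) - Rabs (f t - g t))); lra. }
    rewrite !pow2_abs in H; lra. }
  assert (Hss : s c * s y <= 34 / 5 / b).
  { generalize (pow2_ge_0 (s c - s y)) (Hs c HcT) (Hs y Hy); lra. }
  assert (Hi : 0 < / (2 * b)) by (apply Rinv_0_lt_compat; lra).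
  assert (Hgauge : Rabs (M y) + Rabs (P y) <= 5 / 4 * s y).
  { assert (Hz : Rabs (y / (2 * b)) <= 1 / 4).
    { unfold Rdiv; rewrite Rabs_mult, (Rabs_right (/ (2 * b))) by lra.
      apply (Rmult_le_reg_r (2 * b)); [lra |].
      rewrite Rmult_assoc, Rinv_l by lra; nra. }
    apply Rabs_le_between in Hz.
    unfold M, P, s; rewrite !Rabs_mult.
    rewrite (Rabs_right (1 + y / (2 * b))), (Rabs_right (1 - y / (2 * b))) by lra.
    rewrite Rmult_plus_distr_l, Rplus_comm.
    apply Rplus_le_compat; apply Rmult_le_compat_r; try apply Rabs_pos; lra. }
  (* The factor is [1 + T^2], at most [5 / 4 * T^2] because [T >= 2]. *)
  assert (Hee : Rabs (e1 c) + Rabs (e2 c) <= / (2 * b) * (5 / 4 * T ^ 2) * s c).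
  { assert (Hc2 : 0 <= c ^ 2 <= T ^ 2).
    { apply Rabs_le_between in HcT; split; [apply pow2_ge_0 | nra]. }
    assert (Hlin : forall p q, Rabs (p + c ^ 2 * q) <= Rabs p + T ^ 2 * Rabs q).
    { intros p q; apply Rle_trans with (1 := Rabs_triang _ _).
      rewrite Rabs_mult, (Rabs_right (c ^ 2)) by lra.
      generalize (Rabs_pos q); nra. }
    unfold e1, e2; rewrite !Rabs_mult, Rabs_Ropp, (Rabs_right (/ (2 * b))) by lra.
    rewrite <- Rmult_plus_distr_l, Rmult_assoc.
    apply Rmult_le_compat_l; [lra |].
    assert (H1 := Hlin (f c + g c) (f c - g c)).
    assert (H2 := Hlin (f c - g c) (f c + g c)).
    assert (H3 : 0 <= (T ^ 2 / 4 - 1) * s c) by (apply Rmult_le_pos; [nra | apply Hs0]).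
    unfold s in *; lra. }
  assert (Htrig : forall p q u v, Rabs u <= 1 -> Rabs v <= 1 ->
    Rabs (p * u + q * v) <= Rabs p + Rabs q).
  { intros p q u v Hu Hv; apply Rle_trans with (1 := Rabs_triang _ _).
    rewrite !Rabs_mult; apply Rplus_le_compat;
      rewrite <- Rmult_1_r; apply Rmult_le_compat_l; trivial; apply Rabs_pos. }
  assert (Hcos : Rabs (cos (b * (x - c))) <= 1) by (apply Rabs_le_between, COS_bound).
  assert (Hsin : Rabs (sin (b * (x - c))) <= 1) by (apply Rabs_le_between, SIN_bound).
  apply Rle_trans with ((Rabs (e1 c) + Rabs (e2 c)) * (Rabs (M y) + Rabs (P y))).
  { unfold dPsi; apply Rle_trans with (1 := Rabs_triang _ _).
    rewrite !Rabs_mult, Rmult_plus_distr_r.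
    apply Rplus_le_compat; apply Rmult_le_compat_l; try apply Rabs_pos.
    - apply Htrig; assumption.
    - unfold Rminus; rewrite Ropp_mult_distr_l.
      apply Rle_trans with (1 := Htrig _ _ _ _ Hsin Hcos).
      rewrite Rabs_Ropp; lra. }
  apply Rle_trans with (/ (2 * b) * (5 / 4 * T ^ 2) * s c * (5 / 4 * s y)).
  { apply Rmult_le_compat; trivial;
      generalize (Rabs_pos (e1 c)) (Rabs_pos (e2 c)) (Rabs_pos (M y)) (Rabs_pos (P y)); lra. }
  replace (/ (2 * b) * (5 / 4 * T ^ 2) * s c * (5 / 4 * s y))
    with (/ (2 * b) * (25 / 16 * T ^ 2) * (s c * s y)) by (field; lra).
  apply Rle_trans with (/ (2 * b) * (25 / 16 * T ^ 2) * (34 / 5 / b)).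
  { apply Rmult_le_compat_l; [|exact Hss].
    apply Rmult_le_pos; [lra |]; generalize (pow2_ge_0 T); lra. }
  replace (/ (2 * b) * (25 / 16 * T ^ 2) * (34 / 5 / b))
    with (85 / 16 * (T ^ 2 / b ^ 2)) by (field; lra).
  replace (27 / 5 * T ^ 2 / b ^ 2) with (27 / 5 * (T ^ 2 / b ^ 2)) by (field; lra).
  apply Rmult_le_compat_r; [|lra].
  apply Rdiv_le_0_compat; [apply pow2_ge_0 | apply pow_lt; lra].
Qed.

Lemma wronskian_near_sine (b T : R) (f g : R -> R) (x y : R) :
  2 <= T -> 0 < b -> 4 * T ^ 2 + 2 <= b ^ 2 -> ladder_system b f g ->
  Rabs (corrected_energy b f g 0 - 2 / PI) <= T ^ 2 / (2 * b ^ 2) ->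
  Rabs x <= T -> Rabs y <= T ->
  Rabs (b / 2 * (g x * f y - f x * g y) - 1 / PI * sin (b * (x - y)))
    <= 4 * (T ^ 2 / b) * Rabs (x - y).
Proof.
  intros HT Hb HbT Hfg H0 Hx Hy.
  assert (Hamp := fun t => amplitude_bounds b T f g t HT Hb HbT Hfg H0).
  assert (HD : forall t, Rabs t <= T -> f t ^ 2 + g t ^ 2 <= 17 / 10 / b)
    by (intros t Ht; apply Hamp, Ht).
  assert (HPsi := rotated_gauge_mean_value b T f g x y HT Hb HbT Hfg HD Hx Hy).
  destruct (Hamp y Hy) as [HDy HEy].
  assert (HDx := HD x Hx).
  clear Hamp HD H0 Hfg; cbv zeta in HPsi.
  assert (HPI := inv_PI_bounds).
  set (K := T ^ 2 / b).
  assert (HKb : K * b = T ^ 2) by (unfold K; field; lra).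
  assert (Hb2T : 2 * T <= b) by nra.
  assert (Hi : 0 < / b) by (apply Rinv_0_lt_compat; lra).
  assert (Hib : / b * b = 1) by (apply Rinv_l; lra).
  assert (HKi : K = T ^ 2 * / b) by reflexivity.
  assert (HiK : / b <= K / 4) by (assert (0 <= (T ^ 2 - 4) * / b) by (apply Rmult_le_pos; nra); lra).
  assert (HKi4 : K * / b <= 1 / 4).
  { apply (Rmult_le_reg_r (b ^ 2)); [apply pow_lt; lra |].
    replace (K * / b * b ^ 2) with (K * b * (/ b * b)) by ring.
    rewrite HKb, Hib; lra. }
  assert (Hu := Rabs_pos (x - y)).
  assert (HKu : 0 <= K * Rabs (x - y)) by (apply Rmult_le_pos; lra).
  replace (27 / 5 * T ^ 2 / b ^ 2) with (27 / 5 * K * / b) in HPsi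
    by (unfold K; field; lra).
  replace (5 / 2 * T ^ 2 / b ^ 2) with (5 / 2 * K * / b) in HEy
    by (unfold K; field; lra).
  set (sn := sin (b * (x - y))) in *.
  assert (HS : Rabs sn <= b * Rabs (x - y)).
  { assert (H := Rabs_sin_minus_le (b * (x - y)) 0).
    rewrite sin_0, !Rminus_0_r in H; apply Rle_trans with (1 := H).
    rewrite Rabs_mult, (Rabs_right b) by lra; lra. }
  match type of HPsi with Rabs ?d <= _ => set (D1 := d) in * end.
  (* [D1] is the error of the sine approximation, and [D2] equals
     [b / 4 * (P y ^ 2 + M y ^ 2) - 1 / PI]. [Sg] comes from the part of the gauged Wronskian
     proportional to [x - y]. *)
  set (D2 := (energy b f g y - 2 / PI) / 2 + y ^ 2 * (f y ^ 2 + g y ^ 2) * / b / 8).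
  set (Sg := f x * f y - g x * g y).
  set (W := b / 2 * (g x * f y - f x * g y)).
  set (m := b / 4 * D1 + D2 * sn + (x - y) * Sg / 4).
  (* Undoing the gauge: [zeta] is the product of [x / (2 b)] and [y / (2 b)]. *)
  set (zeta := x * y * / b * / b / 4).
  assert (EW : W * (1 - zeta) = 1 / PI * sn + m).
  { unfold m, D2, W, zeta, D1, Sg, energy; field; generalize PI_RGT_0; lra. }
  assert (HD1 : Rabs (b / 4 * D1) <= 27 / 20 * K * Rabs (x - y)).
  { rewrite Rabs_mult, (Rabs_right (b / 4)) by lra.
    apply Rle_trans with (b / 4 * (27 / 5 * K * / b * Rabs (x - y))).
    - apply Rmult_le_compat_l; lra.
    - replace (b / 4 * (27 / 5 * K * / b * Rabs (x - y)))
        with (27 / 20 * K * (/ b * b) * Rabs (x - y)) by (field; lra).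
      rewrite Hib; lra. }
  assert (HD2 : Rabs D2 <= 59 / 40 * K * / b).
  { assert (Hy2 : 0 <= y ^ 2 <= T ^ 2).
    { apply Rabs_le_between in Hy; split; [apply pow2_ge_0 | nra]. }
    assert (Hd : 0 <= f y ^ 2 + g y ^ 2)
      by (generalize (pow2_ge_0 (f y)) (pow2_ge_0 (g y)); lra).
    assert (Hq : 0 <= y ^ 2 * (f y ^ 2 + g y ^ 2) * / b <= 17 / 10 * K * / b).
    { split; [apply Rmult_le_pos; [apply Rmult_le_pos |]; lra |].
      apply Rmult_le_compat_r; [lra |].
      replace (17 / 10 * K) with (T ^ 2 * (17 / 10 / b)) by (unfold K; field; lra).
      apply Rmult_le_compat; lra. }
    apply Rabs_le_between in HEy; unfold D2; apply Rabs_le_between; lra. }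
  (* Bounding the sine by its argument gains the factor [|x - y|] at the price of a factor [b],
     which the [/ b] in the bound on [D2] pays for. *)
  assert (HD2S : Rabs (D2 * sn) <= 59 / 40 * K * Rabs (x - y)).
  { rewrite Rabs_mult.
    apply Rle_trans with ((59 / 40 * K * / b) * (b * Rabs (x - y))).
    - apply Rmult_le_compat; trivial; apply Rabs_pos.
    - replace (59 / 40 * K * / b * (b * Rabs (x - y)))
        with (59 / 40 * K * (/ b * b) * Rabs (x - y)) by ring.
      rewrite Hib; lra. }
  assert (HSg : Rabs ((x - y) * Sg / 4) <= 17 / 160 * K * Rabs (x - y)).
  { assert (H : Rabs Sg <= 17 / 10 * / b).
    { unfold Sg; apply Rabs_le_between.
      generalize (pow2_ge_0 (f x - f y)) (pow2_ge_0 (f x + f y))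
        (pow2_ge_0 (g x - g y)) (pow2_ge_0 (g x + g y)).
      unfold Rdiv in HDx, HDy; split; lra. }
    unfold Rdiv at 1; rewrite !Rabs_mult, (Rabs_right (/ 4)) by lra.
    assert (Rabs (x - y) * Rabs Sg <= Rabs (x - y) * (17 / 40 * K))
      by (apply Rmult_le_compat_l; lra).
    lra. }
  (* [27 / 20 + 59 / 40 + 17 / 160 < 3]. *)
  assert (Hm : Rabs m <= 3 * K * Rabs (x - y)).
  { unfold m.
    apply Rle_trans with (1 := Rabs_triang _ _).
    assert (H := Rabs_triang (b / 4 * D1) (D2 * sn)).
    lra. }
  assert (Hzeta : Rabs zeta <= K * / b / 4).
  { unfold zeta, Rdiv.
    rewrite !Rabs_mult, (Rabs_right (/ b)), (Rabs_right (/ 4)) by lra.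
    apply Rmult_le_compat_r; [lra |].
    apply Rmult_le_compat_r; [lra |].
    rewrite HKi; apply Rmult_le_compat_r; [lra |].
    simpl; rewrite Rmult_1_r.
    apply Rmult_le_compat; trivial; apply Rabs_pos. }
  (* A crude bound on [W], using [|zeta| <= 1 / 16]; it suffices because [W] reenters only through
     the small product [zeta * W]. *)
  assert (HW : Rabs W * (15 / 16) <= (b / 3 + 3 * K) * Rabs (x - y)).
  { apply Rle_trans with (Rabs (W * (1 - zeta))).
    - rewrite Rabs_mult; apply Rmult_le_compat_l; [apply Rabs_pos |].
      apply Rle_trans with (2 := Rle_abs _).
      generalize (Rle_abs zeta); lra.
    - rewrite EW; apply Rle_trans with (1 := Rabs_triang _ _).
      assert (Rabs (1 / PI * sn) <= 1 / 3 * (b * Rabs (x - y))).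
      { rewrite Rabs_mult, (Rabs_right (1 / PI)) by lra.
        apply Rmult_le_compat; trivial; try lra; apply Rabs_pos. }
      lra. }
  replace (W - 1 / PI * sn) with (m + zeta * W)
    by (replace m with (W * (1 - zeta) - 1 / PI * sn) by lra; ring).
  apply Rle_trans with (1 := Rabs_triang _ _).
  assert (HzW : Rabs (zeta * W) <= K * Rabs (x - y)).
  { rewrite Rabs_mult.
    apply Rle_trans with (K * / b / 4 * (16 / 15 * ((b / 3 + 3 * K) * Rabs (x - y)))).
    - apply Rmult_le_compat; try apply Rabs_pos; lra.
    - replace (K * / b / 4 * (16 / 15 * ((b / 3 + 3 * K) * Rabs (x - y))))
        with (K * Rabs (x - y) * (4 / 15 * ((/ b * b) / 3 + 3 * (K * / b)))) by (field; lra).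
      rewrite Hib.
      apply Rle_trans with (K * Rabs (x - y) * 1); [|lra].
      apply Rmult_le_compat_l; lra. }
  lra.
Qed.

(** * The Hermite pair and its energy at the origin *)

Lemma hermite_ladder_system (n : nat) :
  ladder_system (ladder n) (hermite_fun n) (fun x => - hermite_fun (S n) x).
Proof.
  intros x; split.
  - replace (x * hermite_fun n x - ladder n * - hermite_fun (S n) x)
      with (x * hermite_fun n x + ladder n * hermite_fun (S n) x) by ring.
    apply hermite_fun_derive.
  - replace (ladder n * hermite_fun n x - x * - hermite_fun (S n) x)
      with (- (- ladder n * hermite_fun n x - x * hermite_fun (S n) x)) by ring.
    apply (is_derive_opp (hermite_fun (S n))), hermite_fun_derive_S.
Qed.

(** Factor [b^2 q^2 - 4] as [(b q - 2) (b q + 2)], the second factor being at least [2]. The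
    hypotheses also give [b^2 q^2 <= 9 / 2 < (11 / 5)^2]. *)
Lemma central_amplitude_bounds (b q : R) :
  0 < b -> 18 <= b ^ 2 -> 0 <= q -> Rabs (b ^ 2 * q ^ 2 - 4) <= 2 * q ^ 2 ->
  Rabs (b * q - 2) <= 9 / 2 / b ^ 2 /\ q / b <= 11 / 5 / b ^ 2.
Proof.
  intros Hb Hb2 Hq H; apply Rabs_le_between in H.
  assert (Hq2 := pow2_ge_0 q).
  assert (H18 : 18 * q ^ 2 <= b ^ 2 * q ^ 2) by (apply Rmult_le_compat_r; lra).
  assert (Hp0 : 0 <= b * q) by (apply Rmult_le_pos; lra).
  assert (Hp : b * q <= 11 / 5) by nra.
  split.
  - replace (9 / 2 / b ^ 2) with (9 / 2 * / b ^ 2) by reflexivity.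
    apply (Rmult_le_reg_r (b ^ 2)); [lra |].
    rewrite Rmult_assoc, Rinv_l, Rmult_1_r by lra.
    apply Rle_trans with (Rabs (b ^ 2 * q ^ 2 - 4) / 2 * b ^ 2).
    + apply Rmult_le_compat_r; [lra |].
      replace (b ^ 2 * q ^ 2 - 4) with ((b * q - 2) * (b * q + 2)) by ring.
      rewrite Rabs_mult, (Rabs_right (b * q + 2)) by lra.
      generalize (Rabs_pos (b * q - 2)); nra.
    + assert (Rabs (b ^ 2 * q ^ 2 - 4) <= 2 * q ^ 2) by (apply Rabs_le_between; lra).
      apply Rle_trans with (2 * q ^ 2 / 2 * b ^ 2); [|lra].
      apply Rmult_le_compat_r; lra.
  - replace (q / b) with (b * q * / b ^ 2) by (field; lra).
    apply Rmult_le_compat_r; [left; apply Rinv_0_lt_compat; lra | exact Hp].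
Qed.

Lemma hermite_central_energy (n : nat) :
  8 <= INR n ->
  Rabs (corrected_energy (ladder n) (hermite_fun n) (fun x => - hermite_fun (S n) x) 0
        - 2 / PI) <= 2 / ladder n ^ 2.
Proof.
  intros Hn.
  assert (Hb := ladder_pos n); assert (Hb2 := ladder_sqr n).
  set (b := ladder n) in *.
  assert (HPI := inv_PI_bounds); assert (HPI0 := PI_RGT_0).
  (* By parity one of the two functions vanishes at the origin: [h] is the value of the other and
     [s] the resulting sign of the correction. Wallis is used at the even index, [n] or [n + 1];
     both cases fit the same symmetric bound around [b^2 = 2 n + 2]. *)
  assert (exists h s, Rabs s <= 1 /\
    corrected_energy b (hermite_fun n) (fun x => - hermite_fun (S n) x) 0
      = b * h ^ 2 + s * (h ^ 2 / (2 * b)) /\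
    Rabs (b ^ 2 * (PI * h ^ 2) ^ 2 - 4) <= 2 * (PI * h ^ 2) ^ 2)
    as [h [s [Hs [-> Hh]]]].
  { unfold corrected_energy, energy.
    replace (b ^ 2) with (2 * INR n + 2) by (rewrite <- Hb2; ring).
    destruct (Nat.Even_or_Odd n) as [[m ->] | [m ->]].
    - destruct (hermite_fun_even_0_bounds m) as [L U].
      rewrite hermite_fun_odd_0.
      exists (hermite_fun (2 * m) 0), (-1); split; [|split].
      + rewrite Rabs_left; lra.
      + field; lra.
      + apply Rabs_le_between; lra.
    - replace (S (2 * m + 1)) with (2 * S m)%nat by lia.
      destruct (hermite_fun_even_0_bounds (S m)) as [L U].
      replace (2 * S m)%nat with (S (2 * m + 1)) in * by lia.
      replace (hermite_fun (2 * m + 1) 0) with 0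
        by (rewrite Nat.add_1_r, hermite_fun_odd_0; reflexivity).
      exists (hermite_fun (S (2 * m + 1)) 0), 1; split; [|split].
      + rewrite Rabs_R1; lra.
      + field; lra.
      + rewrite S_INR in L, U; apply Rabs_le_between; lra. }
  set (q := PI * h ^ 2) in *.
  assert (Hq : 0 <= q) by (apply Rmult_le_pos; [lra | apply pow2_ge_0]).
  assert (Hb18 : 18 <= b ^ 2) by (simpl; lra).
  destruct (central_amplitude_bounds b q Hb Hb18 Hq Hh) as [H1 H2].
  replace (b * h ^ 2 + s * (h ^ 2 / (2 * b)) - 2 / PI)
    with (1 / PI * ((b * q - 2) + s * (q / b / 2)))
    by (unfold q; field; lra).
  rewrite Rabs_mult, (Rabs_right (1 / PI)) by lra.
  (* The bracket is at most [(9 / 2 + 11 / 10) / b^2], below [6 / b^2]. *)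
  replace (2 / b ^ 2) with (1 / 3 * (6 / b ^ 2)) by (field; lra).
  apply Rmult_le_compat; try apply Rabs_pos; try lra.
  apply Rle_trans with (1 := Rabs_triang _ _).
  assert (Hqb : 0 <= q / b) by (apply Rdiv_le_0_compat; lra).
  assert (Rabs (s * (q / b / 2)) <= q / b / 2).
  { rewrite Rabs_mult, (Rabs_right (q / b / 2)) by lra.
    rewrite <- (Rmult_1_l (q / b / 2)) at 2.
    apply Rmult_le_compat_r; lra. }
  assert (0 < / b ^ 2) by (apply Rinv_0_lt_compat; lra).
  unfold Rdiv in *; lra.
Qed.

(** * Change of frequency and final estimate *)

(** As [(b - l) (b + l) = 1 = (r - b) (r + b)], each gap is at most [/ b]. The gaps lie on opposite
    sides of [b], so the mean is off by at most half of that. *)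
Lemma mean_frequency_near (b l r : R) :
  0 < b -> 0 <= l -> 0 <= r -> l ^ 2 = b ^ 2 - 1 -> r ^ 2 = b ^ 2 + 1 ->
  Rabs ((l + r) / 2 - b) <= / b / 2.
Proof.
  intros Hb Hl Hr El Er.
  assert (Hlb : l <= b) by nra.
  assert (Hbr : b <= r) by nra.
  assert (H1 : b - l <= / b).
  { apply (Rmult_le_reg_r b); [lra |]; rewrite Rinv_l by lra; nra. }
  assert (H2 : r - b <= / b).
  { apply (Rmult_le_reg_r b); [lra |]; rewrite Rinv_l by lra; nra. }
  apply Rabs_le_between; lra.
Qed.

Theorem theorem2p4 (T : R) (n : nat) (hT : 2 <= T) (hn : 2 * T ^ 2 <= INR n) :
  let N := (sqrt (2 * INR n + 1) + sqrt (2 * INR n + 3)) / 2 in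
  exists Rn : R -> R -> R,
    forall x y : R, Rabs x <= T -> Rabs y <= T ->
      hermite_kernel n x y = 1 / PI * sin_quotient N (x - y) + Rn x y /\
      Rabs (Rn x y) <= 17 * T ^ 2 / sqrt (2 * INR n + 1).
Proof.
  intros N.
  exists (fun x y => hermite_kernel n x y - 1 / PI * sin_quotient N (x - y)).
  intros x y Hx Hy; split; [ring |].
  assert (HT2 : 4 <= T ^ 2) by nra.
  assert (Hb := ladder_pos n); assert (Hb2 := ladder_sqr n).
  assert (Hsys := hermite_ladder_system n).
  assert (H0 := hermite_central_energy n ltac:(lra)).
  assert (CD := christoffel_darboux n x y).
  assert (CDD := christoffel_darboux_diag n x).
  set (b := ladder n) in *.
  set (f := hermite_fun n) in *; set (g := fun x => - hermite_fun (S n) x) in *.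
  assert (HPI := inv_PI_bounds); assert (HPI0 := PI_RGT_0).
  (* As [b^2 = 2 n + 2], this is the hypothesis [2 T^2 <= n] rescaled. *)
  assert (HbT : 4 * T ^ 2 + 2 <= b ^ 2) by (simpl; lra).
  assert (H0' : Rabs (corrected_energy b f g 0 - 2 / PI) <= T ^ 2 / (2 * b ^ 2)).
  { apply Rle_trans with (1 := H0).
    replace (T ^ 2 / (2 * b ^ 2)) with (T ^ 2 / 2 / b ^ 2) by (field; lra).
    apply Rmult_le_compat_r; [left; apply Rinv_0_lt_compat, pow_lt |]; lra. }
  assert (Hl : 0 < sqrt (2 * INR n + 1)) by (apply sqrt_lt_R0; lra).
  assert (El : sqrt (2 * INR n + 1) * sqrt (2 * INR n + 1) = 2 * INR n + 1)
    by (apply sqrt_sqrt; lra).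
  assert (Er : sqrt (2 * INR n + 3) * sqrt (2 * INR n + 3) = 2 * INR n + 3)
    by (apply sqrt_sqrt; lra).
  assert (HN : Rabs (N - b) <= / b / 2).
  { apply mean_frequency_near; try lra; try apply sqrt_pos; simpl; lra. }
  set (K := T ^ 2 / b).
  assert (HbK : / b <= K / 4).
  { assert (0 < / b) by (apply Rinv_0_lt_compat; lra).
    assert (0 <= (T ^ 2 - 4) * / b) by (apply Rmult_le_pos; lra).
    unfold K, Rdiv; lra. }
  assert (HK : 0 < K) by (apply Rdiv_lt_0_compat; lra).
  (* Replacing [b] by the smaller [sqrt (2 n + 1)] only enlarges the bound. *)
  apply Rle_trans with (17 * K).
  2: { unfold K, Rdiv; rewrite Rmult_assoc.
       apply Rmult_le_compat_l; [lra |]; apply Rmult_le_compat_l; [lra |].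
       apply Rinv_le_contravar; nra. }
  unfold sin_quotient; destruct (Req_EM_T (x - y) 0) as [Hxy | Hxy].
  (* On the diagonal the kernel is [b / 2] times the energy; the errors add up to
     [(5 / 4 + 1 / 24) * K]. *)
  - replace y with x by lra.
    destruct (amplitude_bounds b T f g x hT Hb HbT Hsys H0' Hx) as [_ HE].
    replace (hermite_kernel n x x - 1 / PI * N)
      with (b / 2 * (energy b f g x - 2 / PI) - 1 / PI * (N - b))
      by (rewrite CDD; unfold energy, g; field; lra).
    apply Rle_trans with (1 := Rabs_triang _ _).
    rewrite Rabs_Ropp, !Rabs_mult, (Rabs_right (b / 2)), (Rabs_right (1 / PI)) by lra.
    assert (b / 2 * Rabs (energy b f g x - 2 / PI) <= 5 / 4 * K).
    { replace (5 / 4 * K) with (b / 2 * (5 / 2 * T ^ 2 / b ^ 2))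
        by (unfold K; field; lra).
      apply Rmult_le_compat_l; lra. }
    assert (1 / PI * Rabs (N - b) <= 1 / 3 * (/ b / 2))
      by (apply Rmult_le_compat; try apply Rabs_pos; lra).
    lra.
  (* Off the diagonal everything is multiplied by [|x - y|]. Passing from frequency [b] to [N] costs
     [K / 24 * |x - y|] by the Lipschitz bound for the sine, on top of [4 * K * |x - y|]. *)
  - assert (HW := wronskian_near_sine b T f g x y hT Hb HbT Hsys H0' Hx Hy).
    fold K in HW.
    assert (Hu := Rabs_pos_lt _ Hxy).
    apply (Rmult_le_reg_r (Rabs (x - y))); [exact Hu |].
    rewrite <- Rabs_mult.
    replace ((hermite_kernel n x y - 1 / PI * (sin (N * (x - y)) / (x - y))) * (x - y))
      with ((b / 2 * (g x * f y - f x * g y) - 1 / PI * sin (b * (x - y)))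
            - 1 / PI * (sin (N * (x - y)) - sin (b * (x - y)))).
    2: { transitivity ((x - y) * hermite_kernel n x y - 1 / PI * sin (N * (x - y)));
           [rewrite CD; unfold g | ]; field; lra. }
    apply Rle_trans with (1 := Rabs_triang _ _).
    rewrite Rabs_Ropp, (Rabs_mult (1 / PI)), (Rabs_right (1 / PI)) by lra.
    assert (Hsin := Rabs_sin_minus_le (N * (x - y)) (b * (x - y))).
    replace (N * (x - y) - b * (x - y)) with ((N - b) * (x - y)) in Hsin by ring.
    rewrite Rabs_mult in Hsin.
    assert (Rabs (N - b) * Rabs (x - y) <= K / 8 * Rabs (x - y))
      by (apply Rmult_le_compat_r; lra).
    assert (1 / PI * Rabs (sin (N * (x - y)) - sin (b * (x - y)))
            <= 1 / 3 * (K / 8 * Rabs (x - y)))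
      by (apply Rmult_le_compat; try apply Rabs_pos; lra).
    assert (0 < K * Rabs (x - y)) by (apply Rmult_lt_0_compat; lra).
    lra.
Qed.
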